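(* For any formula $\alpha$ over a finite signature $\Sigma$, the set of equilibrium models of $\alpha$ equals $[\![\alpha]\!]_c\setminus\big([\![\alpha]\!]\setminus\mathcal I_c\big)\uparrow$.
   Context: $\Sigma$ is a finite set of atoms. Formulas are given by $\alpha ::= \bot \mid p \mid \alpha_1\wedge\alpha_2 \mid \alpha_1\vee\alpha_2 \mid \alpha_1\rightarrow\alpha_2$ with $p\in\Sigma$. A partial interpretation is a map $v:\Sigma\to\{0,1,2\}$; $\mathcal I$ is the set of all of them and $\mathcal I_c$ the set of classical ones (no atom mapped to $1$). The $G_3$ valuation extends $v$ to formulas: $v(\bot)=0$, $v(\alpha\wedge\beta)=\min(v(\alpha),v(\beta))$, $v(\alpha\vee\beta)=\max(v(\alpha),v(\beta))$, $v(\alpha\to\beta)=2$ if $v(\alpha)\le v(\beta)$ and $=v(\beta)$ otherwise; $v$ is a model of $\alpha$ iff $v(\alpha)=2$. The order on $\mathcal I$: $u\le v$ iff for every atom $p$, $u(p)\le v(p)$ and ($u(p)=0$ implies $v(p)=0$). A classical interpretation $v\in\mathcal I_c$ is an equilibrium model of $\alpha$ iff it is a $\le$-minimal model of $\alpha$. For $S\subseteq\mathcal I$: $\overline S=\mathcal I\setminus S$; $S_c=S\cap\mathcal I_c$; $S\downarrow=\{u\in\mathcal I:\exists v\in S,\ v\ge u\}$; $S\uparrow=\{u\in\mathcal I:\exists v\in S,\ v\le u\}$. The denotation: $[\![\bot]\!]=\emptyset$; $[\![p]\!]=\{v\in\mathcal I: v(p)=2\}$; $[\![\alpha\wedge\beta]\!]=[\![\alpha]\!]\cap[\![\beta]\!]$;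 $[\![\alpha\vee\beta]\!]=[\![\alpha]\!]\cup[\![\beta]\!]$; $[\![\alpha\to\beta]\!]=\big(\overline{[\![\alpha]\!]}\cup[\![\beta]\!]\big)\cap\big(\overline{[\![\alpha]\!]}\cup[\![\beta]\!]\big)_c\downarrow$. *)

(* Defs.v *)
From mathcomp Require Import all_boot all_order.

Set Implicit Arguments.
Unset Strict Implicit.
Unset Printing Implicit Defensive.

Inductive formula (Sigma : Type) : Type :=
| Bot
| Atom of Sigma
| And of formula Sigma & formula Sigma
| Or of formula Sigma & formula Sigma
| Imp of formula Sigma & formula Sigma.

Arguments Bot {Sigma}.

(* The truth values 0, 1, 2 are the elements of 'I_3; ord0 is 0 and
   ord_max is 2. *)
Definition interp (Sigma : finType) := {ffun Sigma -> 'I_3}.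

Definition classical (Sigma : finType) : {set interp Sigma} :=
  [set v : interp Sigma | [forall p, v p != 1 :> nat]].

Fixpoint valuation (Sigma : finType) (v : interp Sigma)
    (a : formula Sigma) : 'I_3 :=
  match a with
  | Bot => ord0
  | Atom p => v p
  | And b c => Order.min (valuation v b) (valuation v c)
  | Or b c => Order.max (valuation v b) (valuation v c)
  | Imp b c =>
      if valuation v b <= valuation v c then ord_max else valuation v c
  end.

Definition model (Sigma : finType) (v : interp Sigma) (a : formula Sigma) :
    bool :=
  valuation v a == ord_max.

Definition interp_le (Sigma : finType) (u v : interp Sigma) : bool :=
  [forall p, (u p <= v p) && ((u p == ord0) ==> (v p == ord0))].

Definition equilibrium_model (Sigma : finType) (a : formula Sigma)
    (v : interp Sigma) : bool :=
  [&& v \in classical Sigma, model v a &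
      [forall u : interp Sigma, model u a ==> interp_le u v ==> (u == v)]].

Definition classical_part (Sigma : finType) (S : {set interp Sigma}) :
    {set interp Sigma} :=
  S :&: classical Sigma.

Definition down (Sigma : finType) (S : {set interp Sigma}) :
    {set interp Sigma} :=
  [set u | [exists v in S, interp_le u v]].

Definition up (Sigma : finType) (S : {set interp Sigma}) :
    {set interp Sigma} :=
  [set u | [exists v in S, interp_le v u]].

Fixpoint denotation (Sigma : finType) (a : formula Sigma) :
    {set interp Sigma} :=
  match a with
  | Bot => set0
  | Atom p => [set v : interp Sigma | v p == ord_max]
  | And b c => denotation b :&: denotation c
  | Or b c => denotation b :|: denotation c
  | Imp b c =>
      (~: denotation b :|: denotation c)
        :&: down (classical_part (~: denotation b :|: denotation c))
  end.

(* Main.v *)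
Require Import Defs.
From mathcomp Require Import all_boot all_order.

Set Implicit Arguments.
Unset Strict Implicit.
Unset Printing Implicit Defensive.

(** Above every partial interpretation lies exactly one classical one, obtained
    by raising the value 1 to 2, and raising commutes with the valuation.  The
    down-closed factor in the denotation of an implication therefore only tests
    the raised interpretation, which makes the denotation equal to the set of
    models.  Distinct classical interpretations being incomparable, minimality
    of a classical model only has to be tested against non-classical models. *)

(** This is double negation in the three-element Gödel chain. *)
Definition raise (x : 'I_3) : 'I_3 := if x == ord0 then ord0 else ord_max.

Definition completion (Sigma : finType) (v : interp Sigma) : interp Sigma :=
  [ffun p => raise (v p)].

Lemma completion_classical (Sigma : finType) (v : interp Sigma) :
  completion v \in classical Sigma.
Proof. by rewrite inE; apply/forallP=> p; rewrite ffunE /raise; case: ifP. Qed.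

Lemma interp_le_completion (Sigma : finType) (v : interp Sigma) :
  interp_le v (completion v).
Proof.
apply/forallP=> p; rewrite ffunE /raise.
by case: (v p) => [[|[|[|m]]] Hm].
Qed.

Lemma interp_le_refl (Sigma : finType) (v : interp Sigma) : interp_le v v.
Proof. by apply/forallP=> p; rewrite leqnn implybb. Qed.

(** Above 0 the order allows only 0; above 1 or 2 the only classical value is 2. *)
Lemma classical_above (Sigma : finType) (u v : interp Sigma) :
  v \in classical Sigma -> interp_le u v -> v = completion u.
Proof.
rewrite inE => /forallP cv /forallP le_uv; apply/ffunP=> p; rewrite ffunE.
move: (cv p) (le_uv p); rewrite /raise.
case: (u p) => [[|[|[|m]]] Hm] //; case: (v p) => [[|[|[|n]]] Hn] //= _ _;
  exact: val_inj.
Qed.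

Lemma classical_interp_le_eq (Sigma : finType) (u v : interp Sigma) :
  u \in classical Sigma -> v \in classical Sigma -> interp_le u v -> u = v.
Proof.
move=> cu cv le_uv; rewrite (classical_above cv le_uv).
exact: classical_above cu (interp_le_refl u).
Qed.

(** Double negation on the chain preserves bottom, min, max and implication. *)
Lemma valuation_completion (Sigma : finType) (v : interp Sigma)
    (a : formula Sigma) :
  valuation (completion v) a = raise (valuation v a).
Proof.
elim: a => [|p|b IHb c IHc|b IHb c IHc|b IHb c IHc] //=; first by rewrite ffunE.
all: rewrite IHb IHc; case: (valuation v b) => [[|[|[|m]]] Hm] //;
  case: (valuation v c) => [[|[|[|n]]] Hn] //; exact: val_inj.
Qed.

Lemma in_down_classical_part (Sigma : finType) (S : {set interp Sigma})
    (v : interp Sigma) :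
  (v \in down (classical_part S)) = (completion v \in S).
Proof.
rewrite inE; apply/exists_inP/idP => [[w /setIP[Sw cw] le_vw]|Sv].
  by rewrite -(classical_above cw le_vw).
exists (completion v); last exact: interp_le_completion.
by rewrite inE Sv completion_classical.
Qed.

Lemma in_denotation (Sigma : finType) (a : formula Sigma) (v : interp Sigma) :
  (v \in denotation a) = model v a.
Proof.
elim: a v => [|p|b IHb c IHc|b IHb c IHc|b IHb c IHc] v;
  rewrite /model /=; first by rewrite inE.
- by rewrite inE.
1,2: rewrite inE IHb IHc /model.
(* The first factor fails when [b] has value 2 and [c] less, the raised one when [b] is nonzero and
   [c] is 0. Together these are exactly the cases where [b] exceeds [c]. *)
3: rewrite inE in_down_classical_part !in_setU !in_setC !IHb !IHc /model
     !valuation_completion.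
all: by case: (valuation v b) => [[|[|[|m]]] Hm] //;
  case: (valuation v c) => [[|[|[|n]]] Hn].
Qed.

Theorem theorem7 (Sigma : finType) (a : formula Sigma) :
  [set v : interp Sigma | equilibrium_model a v] =
  classical_part (denotation a) :\: up (denotation a :\: classical Sigma).
Proof.
apply/setP=> v; rewrite in_set in_setD in_setI in_denotation in_set.
rewrite /equilibrium_model andbA [RHS]andbC [model v a && _]andbC.
case: (boolP (v \in classical Sigma)) => //= cv; congr (_ && _).
rewrite negb_exists; apply: eq_forallb => u.
rewrite in_setD in_denotation.
case: (model u a); rewrite ?andbF ?andbT //=.
have [le_uv|_] := boolP (interp_le u v); rewrite ?andbF ?andbT //= negbK.
(* For a model [u] below the classical [v], being [v] and being classical coincide. *)
apply/eqP/idP => [-> //|cu]; exact: classical_interp_le_eq.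
Qed.
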